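(* For all formulae $A,B$, the following formulae are derivable in $\mathbf{GMALL}+M$, i.e. $\mathbf{GMALL}$ extended with the mingle rule $M$: (1) $\boxdot A\to\Diamond A$; (2) $(\Diamond A\to\Diamond B)\to\Diamond(A\to B)$.
   Context: Formulae are built from propositional variables and constants $0,1,\bot,\top$ using the connectives $\otimes$, $\oplus$ (multiplicative disjunction, ''par''), $\land$, $\lor$ (additive conjunction and disjunction), $\neg$, $\to$. A sequent $\Gamma\Rightarrow\Delta$ is a pair of finite multisets of formulae; commas denote multiset union. A formula $C$ is derivable in a calculus if the sequent ${}\Rightarrow C$ is derivable. The calculus $\mathbf{GMALL}$ for Multiplicative Additive Linear Logic has the following rules (no cut, weakening or contraction). Axioms: $A\Rightarrow A$; $0\Rightarrow{}$; ${}\Rightarrow 1$; $\bot,\Gamma\Rightarrow\Delta$; $\Gamma\Rightarrow\Delta,\top$. $(R0)$ from $\Gamma\Rightarrow\Delta$ infer $\Gamma\Rightarrow\Delta,0$. $(L1)$ from $\Gamma\Rightarrow\Delta$ infer $1,\Gamma\Rightarrow\Delta$. $(L\otimes)$ from $\Gamma,A,B\Rightarrow\Delta$ infer $A\otimes B,\Gamma\Rightarrow\Delta$. $(R\otimes)$ from $\Gamma\Rightarrow\Delta,A$ and $\Gamma'\Rightarrow\Delta',B$ infer $\Gamma,\Gamma'\Rightarrow\Delta,\Delta',A\otimes B$. $(L\oplus)$ from $A,\Gamma\Rightarrow\Delta$ and $B,\Gamma'\Rightarrow\Delta'$ infer $A\oplus B,\Gamma,\Gamma'\Rightarrow\Delta,\Delta'$.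 $(R\oplus)$ from $\Gamma\Rightarrow\Delta,A,B$ infer $\Gamma\Rightarrow\Delta,A\oplus B$. $(L\land_1),(L\land_2)$ from $A,\Gamma\Rightarrow\Delta$, respectively from $B,\Gamma\Rightarrow\Delta$, infer $A\land B,\Gamma\Rightarrow\Delta$. $(R\land)$ from $\Gamma\Rightarrow\Delta,A$ and $\Gamma\Rightarrow\Delta,B$ infer $\Gamma\Rightarrow\Delta,A\land B$. $(L\lor)$ from $A,\Gamma\Rightarrow\Delta$ and $B,\Gamma\Rightarrow\Delta$ infer $A\lor B,\Gamma\Rightarrow\Delta$. $(R\lor_1),(R\lor_2)$ from $\Gamma\Rightarrow\Delta,A$, respectively from $\Gamma\Rightarrow\Delta,B$, infer $\Gamma\Rightarrow\Delta,A\lor B$. $(L\neg)$ from $\Gamma\Rightarrow\Delta,A$ infer $\neg A,\Gamma\Rightarrow\Delta$. $(R\neg)$ from $A,\Gamma\Rightarrow\Delta$ infer $\Gamma\Rightarrow\Delta,\neg A$. $(L\to)$ from $\Gamma\Rightarrow\Delta,A$ and $B,\Gamma'\Rightarrow\Delta'$ infer $A\to B,\Gamma,\Gamma'\Rightarrow\Delta,\Delta'$. $(R\to)$ from $A,\Gamma\Rightarrow\Delta,B$ infer $\Gamma\Rightarrow\Delta,A\to B$. The mingle rule $(M)$: from $\Gamma\Rightarrow\Delta$ and $\Gamma'\Rightarrow\Delta'$ infer $\Gamma,\Gamma'\Rightarrow\Delta,\Delta'$. The Tarskian modalities are the abbreviations $\Diamond A := \neg A\to A$ and $\boxdot A :=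 \neg\Diamond\neg A$. *)

(* Defs.v *)
From HB Require Import structures.
From mathcomp Require Import all_boot.
From mathcomp Require Import finmap multiset.
Set Implicit Arguments.
Unset Strict Implicit.
Unset Printing Implicit Defensive.
Local Open Scope mset_scope.

(* Zero and One are the multiplicative constants 0 and 1 (units of par and
   tensor); Bot and Top are the additive ones. *)
Inductive form : Type :=
| Var of nat
| Zero | One | Bot | Top
| Tensor of form & form
| Par of form & form
| And of form & form
| Or of form & form
| Neg of form
| Imp of form & form.

(* Multisets of formulae need a choiceType structure on [form]; it is
   transported from generic trees. *)
Fixpoint tree_of_form (A : form) : GenTree.tree nat :=
  match A with
  | Var n => GenTree.Leaf n
  | Zero => GenTree.Node 0 [::]
  | One => GenTree.Node 1 [::]
  | Bot => GenTree.Node 2 [::]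
  | Top => GenTree.Node 3 [::]
  | Tensor A B => GenTree.Node 4 [:: tree_of_form A; tree_of_form B]
  | Par A B => GenTree.Node 5 [:: tree_of_form A; tree_of_form B]
  | And A B => GenTree.Node 6 [:: tree_of_form A; tree_of_form B]
  | Or A B => GenTree.Node 7 [:: tree_of_form A; tree_of_form B]
  | Neg A => GenTree.Node 8 [:: tree_of_form A]
  | Imp A B => GenTree.Node 9 [:: tree_of_form A; tree_of_form B]
  end.

Fixpoint form_of_tree (t : GenTree.tree nat) : form :=
  match t with
  | GenTree.Leaf n => Var n
  | GenTree.Node 0 [::] => Zero
  | GenTree.Node 1 [::] => One
  | GenTree.Node 2 [::] => Bot
  | GenTree.Node 3 [::] => Top
  | GenTree.Node 4 [:: t; u] => Tensor (form_of_tree t) (form_of_tree u)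
  | GenTree.Node 5 [:: t; u] => Par (form_of_tree t) (form_of_tree u)
  | GenTree.Node 6 [:: t; u] => And (form_of_tree t) (form_of_tree u)
  | GenTree.Node 7 [:: t; u] => Or (form_of_tree t) (form_of_tree u)
  | GenTree.Node 8 [:: t] => Neg (form_of_tree t)
  | GenTree.Node 9 [:: t; u] => Imp (form_of_tree t) (form_of_tree u)
  | _ => Zero
  end.

Lemma tree_of_formK : cancel tree_of_form form_of_tree.
Proof.
by elim=> //= [A IHA B IHB|A IHA B IHB|A IHA B IHB|A IHA B IHB|A IHA
  |A IHA B IHB]; rewrite ?IHA ?IHB.
Qed.

HB.instance Definition _ := Countable.copy form (can_type tree_of_formK).

Definition Diamond (A : form) : form := Imp (Neg A) A.
Definition Boxdot (A : form) : form := Neg (Diamond (Neg A)).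

Definition sequent : Type := ({mset form} * {mset form})%type.

Notation "G ==>> D" := ((G, D) : sequent)
  (at level 70, no associativity) : mset_scope.

(* [r ps s] : [s] follows from the list of premises [ps] by an instance of [r];
   axioms are the instances without premises. *)
Definition rule : Type := seq sequent -> sequent -> Prop.

Inductive derivable (r : rule) (s : sequent) : Prop :=
| Derive (ps : seq sequent) of
    r ps s & (forall p, p \in ps -> derivable r p).

Definition extend (r r' : rule) : rule := fun ps s => r ps s \/ r' ps s.

Definition derivable_form (r : rule) (C : form) : Prop :=
  derivable r (mset0 ==>> [mset C]).

Implicit Types (A B C : form) (G D : {mset form}).

(* The comma is [`+`], which adds multiplicities ([`|`] takes their maxima). *)
Inductive GMALL : rule :=
| Ax A : GMALL [::] ([mset A] ==>> [mset A])
| AxL0 : GMALL [::] ([mset Zero] ==>> mset0)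
| AxR1 : GMALL [::] (mset0 ==>> [mset One])
| AxLBot G D : GMALL [::] (Bot +` G ==>> D)
| AxRTop G D : GMALL [::] (G ==>> D `+` [mset Top])
| R0 G D : GMALL [:: G ==>> D] (G ==>> D `+` [mset Zero])
| L1 G D : GMALL [:: G ==>> D] (One +` G ==>> D)
| LTensor G D A B :
    GMALL [:: G `+` [mset A] `+` [mset B] ==>> D] (Tensor A B +` G ==>> D)
| RTensor G D G' D' A B :
    GMALL [:: G ==>> D `+` [mset A]; G' ==>> D' `+` [mset B]]
      (G `+` G' ==>> D `+` D' `+` [mset Tensor A B])
| LPar G D G' D' A B :
    GMALL [:: A +` G ==>> D; B +` G' ==>> D']
      (Par A B +` (G `+` G') ==>> D `+` D')
| RPar G D A B :
    GMALL [:: G ==>> D `+` [mset A] `+` [mset B]] (G ==>> D `+` [mset Par A B])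
| LAnd1 G D A B : GMALL [:: A +` G ==>> D] (And A B +` G ==>> D)
| LAnd2 G D A B : GMALL [:: B +` G ==>> D] (And A B +` G ==>> D)
| RAnd G D A B :
    GMALL [:: G ==>> D `+` [mset A]; G ==>> D `+` [mset B]]
      (G ==>> D `+` [mset And A B])
| LOr G D A B :
    GMALL [:: A +` G ==>> D; B +` G ==>> D] (Or A B +` G ==>> D)
| ROr1 G D A B : GMALL [:: G ==>> D `+` [mset A]] (G ==>> D `+` [mset Or A B])
| ROr2 G D A B : GMALL [:: G ==>> D `+` [mset B]] (G ==>> D `+` [mset Or A B])
| LNeg G D A : GMALL [:: G ==>> D `+` [mset A]] (Neg A +` G ==>> D)
| RNeg G D A : GMALL [:: A +` G ==>> D] (G ==>> D `+` [mset Neg A])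
| LImp G D G' D' A B :
    GMALL [:: G ==>> D `+` [mset A]; B +` G' ==>> D']
      (Imp A B +` (G `+` G') ==>> D `+` D')
| RImp G D A B :
    GMALL [:: A +` G ==>> D `+` [mset B]] (G ==>> D `+` [mset Imp A B]).

Inductive Mingle : rule :=
| M G D G' D' : Mingle [:: G ==>> D; G' ==>> D'] (G `+` G' ==>> D `+` D').

(* Main.v *)
From mathcomp Require Import all_boot.
From mathcomp Require Import finmap multiset.
Require Import Defs.

(** Up to derivability the modality [Diamond A] is the par of [A] with itself:
on the left it splits into two copies of [A] ([DiamondL]), and on the right it
can be introduced from two copies ([DiamondR]), in both cases without mingle.
Dually, [Boxdot A] on the left amounts to two copies of [A].  Decomposing the
modalities this way, every leaf of the search for (1) and (2) is either an
instance of [DiamondL] or the sequent with two copies of [A] on each side,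
which is the mingle of two identity axioms ([mingle_id]). *)

Local Open Scope mset_scope.

Local Notation provable G D := (derivable (extend GMALL Mingle) (G, D)).

Lemma infer0 (s : sequent) : GMALL [::] s -> derivable (extend GMALL Mingle) s.
Proof. by move=> rs; apply: Derive (or_introl rs) _. Qed.

Lemma infer1 (p s : sequent) :
  GMALL [:: p] s -> derivable (extend GMALL Mingle) p ->
  derivable (extend GMALL Mingle) s.
Proof.
by move=> rs dp; apply: Derive (or_introl rs) _ => q; rewrite inE => /eqP ->.
Qed.

Lemma infer2 (p q s : sequent) :
  extend GMALL Mingle [:: p; q] s ->
  derivable (extend GMALL Mingle) p -> derivable (extend GMALL Mingle) q ->
  derivable (extend GMALL Mingle) s.
Proof.
by move=> rs dp dq; apply: Derive rs _ => t; rewrite !inE => /orP[] /eqP ->.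
Qed.

Lemma mingle_id (A : form) :
  provable ([mset A] `+` [mset A]) ([mset A] `+` [mset A]).
Proof.
by apply: infer2 (or_intror (M _ _ _ _)) _ _; apply: infer0; apply: Ax.
Qed.

(** The two copies of [A] on the right of an implication [Neg A -> A] come from
its two premises: one from the excluded middle [A, Neg A], one from [A]. *)
Lemma DiamondL (A : form) : provable [mset Diamond A] ([mset A] `+` [mset A]).
Proof.
have idA : provable [mset A] [mset A] by apply: infer0; apply: Ax.
have emA : provable mset0 ([mset A] `+` [mset Neg A]).
  by apply: infer1 (RNeg _ _ _) _; rewrite msetD0.
rewrite -[[mset Diamond A]]msetD0 -[mset0]msetD0.
by apply: infer2 (or_introl (LImp _ _ _ _ _ _)) emA _; rewrite msetD0.
Qed.

Lemma DiamondR (G D : {mset form}) (A : form) :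
  provable G (D `+` [mset A] `+` [mset A]) -> provable G (D `+` [mset Diamond A]).
Proof.
by move=> dAA; apply: infer1 (RImp _ _ _ _) _; apply: infer1 (LNeg _ _ _) _.
Qed.

Lemma Boxdot_sub_Diamond (A : form) :
  provable [mset Boxdot A] [mset Diamond A].
Proof.
rewrite -[[mset Diamond A]]mset0D -[[mset Boxdot A]]msetD0.
apply: DiamondR; apply: infer1 (LNeg _ _ _) _; apply: DiamondR.
do 2!apply: infer1 (RNeg _ _ _) _.
by rewrite mset0D msetD0; apply: mingle_id.
Qed.

Lemma Imp_Diamond_sub_Diamond_Imp (A B : form) :
  provable [mset Imp (Diamond A) (Diamond B)] [mset Diamond (Imp A B)].
Proof.
rewrite -[[mset Diamond (Imp _ _)]]mset0D; apply: DiamondR.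
apply: infer1 (RImp _ _ _ _) _.
(* The other copy of [Imp A B] must be last to be decomposed in turn. *)
rewrite -msetDA [[mset Imp A B] `+` _]msetDC msetDA.
apply: infer1 (RImp _ _ _ _) _.
have AA : provable ([mset A] `+` [mset A]) [mset Diamond A].
  by rewrite -[[mset Diamond A]]mset0D; apply: DiamondR; rewrite mset0D;
     apply: mingle_id.
rewrite msetDA msetDC -[[mset A] `+` [mset A]]msetD0 -[X in (_, X)]msetDA.
apply: infer2 (or_introl (LImp _ _ _ _ _ _)) _ _; first by rewrite mset0D.
by rewrite msetD0; apply: DiamondL.
Qed.

Theorem mainTheorem6 (A B : form) :
  derivable_form (extend GMALL Mingle) (Imp (Boxdot A) (Diamond A)) /\
  derivable_form (extend GMALL Mingle)
    (Imp (Imp (Diamond A) (Diamond B)) (Diamond (Imp A B))).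
Proof.
have deduction C D : provable [mset C] [mset D] ->
    derivable_form (extend GMALL Mingle) (Imp C D).
  move=> dCD; rewrite /derivable_form -[[mset Imp C D]]mset0D.
  by apply: infer1 (RImp _ _ _ _) _; rewrite msetD0 mset0D.
split; apply: deduction.
  exact: Boxdot_sub_Diamond.
exact: Imp_Diamond_sub_Diamond_Imp.
Qed.
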